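(* Let $P$ be a unit interval order canonically labeled by $[n]$ and let $A$ be its antiadjacency matrix. Number the $n$ vertical steps of the semiorder path of $A$ from bottom to top by $1,\dots,n$ and the $n$ horizontal steps from left to right by $n+1,\dots,2n$. Let $(s_1,\dots,s_{2n})$ be the sequence of labels read along the semiorder path in the northwest direction (from the lower-right corner to the upper-left corner). Then the decorated permutation associated to the unit interval positroid induced by $P$ is the cycle $(s_1\ s_2\ \dots\ s_{2n})$, i.e., it sends $s_k\mapsto s_{k+1}$ for $k<2n$ and $s_{2n}\mapsto s_1$.
   Context: A poset $P$ is a unit interval order if there is a bijection $i\mapsto[q_i,q_i+1]$ to closed unit intervals of $\mathbb{R}$ with $i<_P j$ iff $q_i+1<q_j$. For a poset labeled bijectively by $[n]$, the altitude of $i$ is $\alpha(i)=|\{j: j\le_P i\}|-|\{j: i\le_P j\}|$; the labeling is canonical if $\alpha(i)<\alpha(j)$ implies $i<j$. The antiadjacency matrix is the $n\times n$ $0/1$ matrix $(a_{i,j})$ with $a_{i,j}=0$ iff $i<_P j$; for a canonical labeling it is a Dyck matrix, i.e., its zero entries form a right-justified Young diagram anchored at the upper-right corner strictly above the main diagonal. The semiorder path of such a matrix is the lattice path of $n$ east and $n$ south unit steps from the upper-left corner to the lower-right corner of the $n\times n$ grid separating the zero entries from the one entries. For an $n\times n$ matrix $A=(a_{i,j})$, $\psi(A)$ is the $n\times 2n$ matrix whose first $n$ columns form $I_n$ and whose column $n+j$ has entry $(-1)^{n-i}a_{n+1-i,j}$ in row $i$; the unit interval positroid induced by $P$ is the matroid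 on $[2n]$ whose bases are the $n$-subsets indexing linearly independent columns of $\psi(A)$. For $i\in[2n]$ let $<_i$ be the order $i<_i\dots<_i 2n<_i 1<_i\dots<_i i-1$ and $I_i$ the lexicographically minimal basis w.r.t. $<_i$ (indices mod $2n$); the associated decorated permutation $\sigma$ is given by $\sigma(j)=i$ if $I_{i+1}=(I_i\setminus\{i\})\cup\{j\}$, $j\neq i$, and $i$ is a fixed point (clockwise if $i\notin I_i$, counterclockwise if $i\in I_i$) if $I_{i+1}=I_i$. *)

(* Defs.v *)
From HB Require Import structures.
From mathcomp Require Import all_boot all_order all_algebra all_fingroup.
From mathcomp Require Import reals.

Set Implicit Arguments.
Unset Strict Implicit.
Unset Printing Implicit Defensive.

Import Order.TTheory GRing.Theory Num.Theory.
Local Open Scope ring_scope.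

(* All labels and indices start at 0: the label i of [n] is the ordinal of
   value i - 1 in 'I_n, and likewise for [2n] and 'I_(n + n). *)

(* Injectivity of q says that distinct elements get distinct intervals. *)
Definition unit_interval_order (R : realType) d (P : finPOrderType d) : Prop :=
  exists q : P -> R,
    injective q /\ forall x y : P, (x < y)%O = (q x + 1 < q y).

Definition altitude d (P : finPOrderType d) (x : P) : int :=
  #|[set y : P | (y <= x)%O]|%:Z - #|[set y : P | (x <= y)%O]|%:Z.

(* f i is the element of P labeled by i. *)
Definition canonical_labeling d (P : finPOrderType d) n (f : 'I_n -> P) : Prop :=
  bijective f /\
  forall i j : 'I_n, altitude (f i) < altitude (f j) -> (i < j)%N.

Definition antiadjacency (R : realType) d (P : finPOrderType d) n
    (f : 'I_n -> P) : 'M[R]_n :=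
  \matrix_(i, j) (if (f i < f j)%O then 0 else 1).

Variant step := East | South.

Definition is_east (s : step) : bool := if s is East then true else false.
Definition is_south (s : step) : bool := if s is South then true else false.

(* A path is listed from the upper-left to the lower-right corner; after p
   steps it is at the grid point (souths w p, easts w p), counted in rows from
   the top and in columns from the left. *)
Definition easts (w : seq step) (p : nat) : nat := count is_east (take p w).
Definition souths (w : seq step) (p : nat) : nat := count is_south (take p w).

(* The cell in row i and column j lies to the right of the path, i.e. the
   vertical step crossing row i is on the left of column j. *)
Definition right_of_path (w : seq step) (i j : nat) : Prop :=
  exists p : nat, [/\ (p < size w)%N, nth East w p = South,
                      souths w p = i & (easts w p <= j)%N].

Definition semiorder_path (R : realType) n (A : 'M[R]_n) (w : seq step) : Prop :=
  [/\ count is_east w = n, count is_south w = n &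
      forall i j : 'I_n, A i j = 0 <-> right_of_path w i j].

(* Label of the step at position p: vertical steps are numbered from bottom to
   top by 0, ..., n - 1, horizontal ones from left to right by
   n, ..., 2n - 1. *)
Definition step_label n (w : seq step) (p : nat) : nat :=
  if nth East w p is South then (n - (souths w p).+1)%N else (n + easts w p)%N.

Definition northwest_labels n (w : seq step) : seq nat :=
  rev [seq step_label n w p | p <- iota 0 (size w)].

(* With i starting at 0, n - i becomes n - 1 - i and row n + 1 - i becomes row
   n - 1 - i, which is the value of rev_ord i in both cases. *)
Definition psi (R : realType) n (A : 'M[R]_n) : 'M[R]_(n, n + n) :=
  row_mx 1%:M (\matrix_(i, j) ((-1) ^+ rev_ord i * A (rev_ord i) j)).

(* A matroid on [m] is represented by its family of bases. *)
Definition column_matroid (R : realType) n m (M : 'M[R]_(n, m)) :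
    {set {set 'I_m}} :=
  [set S : {set 'I_m} | (#|S| == n) && free [seq col j M | j in S]].

Definition unit_interval_positroid (R : realType) d (P : finPOrderType d) n
    (f : 'I_n -> P) : {set {set 'I_(n + n)}} :=
  column_matroid (psi (antiadjacency R f)).

(* Rank of x in the shifted order i < i + 1 < ... < i - 1 on 'I_m. *)
Definition cyclic_rank m (i x : 'I_m) : nat := ((x + (m - i)) %% m)%N.

(* S, written increasingly for the order starting at i, with every element
   replaced by its rank. *)
Definition cyclic_word m (i : 'I_m) (S : {set 'I_m}) : seqlexi nat :=
  sort leq [seq cyclic_rank i x | x in S].

Definition lex_le m (i : 'I_m) (S T : {set 'I_m}) : bool :=
  (cyclic_word i S <= cyclic_word i T)%O.

(* The default value set0 is only taken when there are no bases. *)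
Definition lex_min_basis m (B : {set {set 'I_m}}) (i : 'I_m) : {set 'I_m} :=
  odflt set0 [pick S in B | [forall T in B, lex_le i S T]].

(* The fixed points outside dp_clockwise are the counterclockwise ones. *)
Record decorated_perm m := DecoratedPerm {
  dp_perm :> {perm 'I_m};
  dp_clockwise : {set 'I_m};
  dp_clockwise_fixed : [forall i in dp_clockwise, dp_perm i == i]
}.

(* If i is a loop, then I_(i+1) = I_i = (I_i \ i) + j for all j in I_i; the case
   I_(i+1) = I_i takes precedence, and i is a fixed point. *)
Definition decorated_perm_of m (B : {set {set 'I_m}}) (s : decorated_perm m) :
    Prop :=
  forall i : 'I_m,
    let I := lex_min_basis B i in
    let I' := lex_min_basis B (ordS i) in
    (I' = I -> s i = i /\ (i \in dp_clockwise s) = (i \notin I)) /\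
    (I' <> I -> forall j : 'I_m, j != i -> I' = j |: (I :\ i) -> s j = i).

(* Main.v *)
Require Import Defs.
From HB Require Import structures.
From mathcomp Require Import all_boot all_order all_algebra all_fingroup.
From mathcomp Require Import reals.
From mathcomp Require Import zify.

Set Implicit Arguments.
Unset Strict Implicit.
Unset Printing Implicit Defensive.

Import Order.TTheory GRing.Theory Num.Theory.

(** The lexicographically minimal bases are the greedy ones, and passing from
    I_i to I_(i+1) replaces i by the first j after i, cyclically, such that
    column i lies in the span of the columns i+1, ..., j. Let h e be the number
    of zeros in column e of the antiadjacency matrix. Up to signs, column i < n
    of psi A is the edge {i, i+1} and column n + e the edge {0, n - h e} of a
    graph on the vertices 0, ..., n, so that the positroid is graphic. If j
    labels the step following step i on the semiorder path, then the edges
    strictly between i and j, cyclically, all avoid one end v of edge i (v = i,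
    respectively v = n - h e), and edge j closes a cycle with them and i. *)

(** * Lattice paths *)

Lemma nth_count T (x0 : T) (a : pred T) (s : seq T) k :
  k < count a s ->
  exists p, [/\ p < size s, a (nth x0 s p) & count a (take p s) = k].
Proof.
elim: s k => [|x s IHs] k //=; case: (boolP (a x)) => ax.
  case: k => [|k] lt_k; first by exists 0.
  have [p [lt_p a_p <-]] := IHs k lt_k.
  by exists p.+1; rewrite /= ax.
rewrite add0n => /IHs[p [lt_p a_p <-]].
by exists p.+1; rewrite /= (negPf ax).
Qed.

Lemma easts_souths w p : p <= size w -> easts w p + souths w p = p.
Proof.
move=> le_p; rewrite /easts /souths -[RHS](size_takel le_p) -(count_predC is_east).
by congr (_ + _); apply: eq_count => -[].
Qed.

Lemma eastsS w p : p < size w ->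
  easts w p.+1 = easts w p + is_east (nth East w p).
Proof. by move=> lt_p; rewrite /easts (take_nth East) // -cats1 count_cat /= addn0. Qed.

Lemma southsS w p : p < size w ->
  souths w p.+1 = souths w p + is_south (nth East w p).
Proof. by move=> lt_p; rewrite /souths (take_nth East) // -cats1 count_cat /= addn0. Qed.

Lemma leq_easts w p p' : p <= p' -> easts w p <= easts w p'.
Proof. by move=> le_p; rewrite /easts -(subnKC le_p) takeD count_cat leq_addr. Qed.

Lemma leq_souths w p p' : p <= p' -> souths w p <= souths w p'.
Proof. by move=> le_p; rewrite /souths -(subnKC le_p) takeD count_cat leq_addr. Qed.

Lemma east_step w j : j < count is_east w ->
  exists p, [/\ p < size w, nth East w p = East & easts w p = j].
Proof.
by case/(nth_count East)=> p [lt_p]; case E: (nth _ _ _) => // _; exists p.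
Qed.

Lemma south_step w j : j < count is_south w ->
  exists p, [/\ p < size w, nth East w p = South & souths w p = j].
Proof.
by case/(nth_count East)=> p [lt_p]; case E: (nth _ _ _) => // _; exists p.
Qed.

Lemma size_steps w : size w = count is_east w + count is_south w.
Proof. by rewrite -(easts_souths (leqnn _)) /easts /souths take_size. Qed.

(** Describes a path by the depths of its east steps; for the semiorder path, [h j] is the number of
    zeros in column [j]. *)
Definition has_heights (h : nat -> nat) (w : seq step) : Prop :=
  forall p, p < size w -> nth East w p = East -> souths w p = h (easts w p).

Lemma has_heights_exists (h : nat -> nat) k m :
    {homo h : i j / i <= j} -> (forall j, j < k -> h j <= m) ->
  exists w, [/\ count is_east w = k, count is_south w = m & has_heights h w].
Proof.
move=> h_mono; elim: k m => [|k IHk] m h_le.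
  exists (nseq m South); split; rewrite ?count_nseq ?mul0n ?mul1n //.
  by move=> p; rewrite size_nseq nth_nseq => ->.
(* The path over the first [k] columns stops at depth [h k], where the last east step belongs. *)
have [|w [wE wS wh]] := IHk (h k); first by move=> j /ltnW /h_mono.
exists (w ++ East :: nseq (m - h k) South); split.
- by rewrite count_cat /= count_nseq mul0n wE; lia.
- rewrite count_cat /= count_nseq mul1n wS; have := h_le k (ltnSn k); lia.
- move=> p lt_p; rewrite nth_cat /easts /souths take_cat.
  case: ltnP => [|_]; first exact: wh.
  case eq_q: (p - size w) => [|q] /=; first by rewrite !cats0 wE wS.
  by rewrite nth_nseq; case: ltnP => // le_q; move: lt_p; rewrite size_cat /= size_nseq; lia.
Qed.

Section Heights.

Variables (n : nat) (h : nat -> nat) (w : seq step).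
Hypotheses (h_mono : {homo h : i j / i <= j}) (h_le : forall j, h j <= j).
Hypotheses (wE : count is_east w = n) (wS : count is_south w = n).

Lemma size_balanced : size w = n + n.
Proof. by rewrite size_steps wE wS. Qed.

Lemma easts_east p : p < n + n -> nth East w p = East -> easts w p < n.
Proof.
move=> lt_p Ep; have := leq_easts w lt_p; rewrite -size_balanced {2}/easts take_size wE.
by rewrite eastsS ?size_balanced // Ep /=; lia.
Qed.

Lemma souths_south p : p < n + n -> nth East w p = South -> souths w p < n.
Proof.
move=> lt_p Ep; have := leq_souths w lt_p; rewrite -size_balanced {2}/souths take_size wS.
by rewrite southsS ?size_balanced // Ep /=; lia.
Qed.

(** The cell [(i, j)] is right of the path exactly when the vertical step through row [i] precedes
    the east step over column [j], that is, when [i] is less than the depth of the latter. *)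
Lemma has_heightsP :
  has_heights h w <->
  (forall i j, i < n -> j < n -> i < h j <-> right_of_path w i j).
Proof.
split=> [wh i j lt_i lt_j | wr p lt_p Ep].
  have [|p [lt_p Ep <-]] := @east_step w j; first by rewrite wE.
  rewrite -wh //; split=> [lt_ip | [p' [lt_p' Sp' <-]]].
    have [|p' [lt_p' Sp' eq_i]] := @south_step w i; first by rewrite wS.
    exists p'; split=> //; apply: leq_easts; rewrite leqNgt; apply/negP => lt_pp.
    by have := leq_souths w (ltnW lt_pp); lia.
  move=> le_e; have := @leq_souths w p'.+1 p; rewrite southsS // Sp' addn1; apply.
  have [//|lt_pp|eq_p] := ltngtP p' p; last by rewrite -eq_p Sp' in Ep.
  by have := leq_easts w lt_pp; rewrite eastsS // Ep /=; lia.
have lt_e : easts w p < n by apply: easts_east; rewrite -?size_balanced.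
apply/eqP; rewrite eqn_leq; apply/andP; split.
  (* If the path were deeper than [h e] at east step [e], it would have crossed row [h e] before,
     putting the cell [(h e, e)] on its right. *)
  rewrite leqNgt; apply/negP => lt_h.
  have [|p' [lt_p' Sp' eq_h]] := @south_step w (h (easts w p)).
    rewrite wS; apply: leq_trans lt_h _.
    by rewrite /souths -wS -{2}(cat_take_drop p w) count_cat leq_addr.
  have lt_hn : h (easts w p) < n by exact: leq_ltn_trans (h_le _) lt_e.
  suff /(wr _ _ lt_hn lt_e) : right_of_path w (h (easts w p)) (easts w p) by rewrite ltnn.
  exists p'; split=> //; apply: leq_easts.
  rewrite leqNgt; apply/negP => lt_pp.
  by have := leq_souths w (ltnW lt_pp); lia.
rewrite leqNgt; apply/negP => lt_h.
have lt_sn : souths w p < n by exact: leq_trans lt_h (leq_trans (h_le _) (ltnW lt_e)).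
have /(wr _ _ lt_sn lt_e) [p' [lt_p' Sp' eq_s le_e]] := lt_h.
have [lt_pp|lt_pp|eq_p] := ltngtP p p'.
- by have := leq_easts w lt_pp; rewrite eastsS // Ep /=; lia.
- by have := leq_souths w lt_pp; rewrite southsS // Sp' /=; lia.
- by rewrite -eq_p Ep in Sp'.
Qed.

Hypothesis wh : has_heights h w.

Lemma east_position j : j < n ->
  [/\ j + h j < n + n, nth East w (j + h j) = East,
      easts w (j + h j) = j & souths w (j + h j) = h j].
Proof.
move=> lt_j; have [|p [lt_p Ep eq_j]] := @east_step w j; first by rewrite wE.
have eq_h := wh lt_p Ep; rewrite eq_j in eq_h.
have eq_p : p = j + h j by rewrite -(easts_souths (ltnW lt_p)) eq_j eq_h.
by rewrite -eq_p -size_balanced.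
Qed.

Lemma nth_east p : p < n + n ->
  is_east (nth East w p) = has (fun j => p == j + h j) (iota 0 n).
Proof.
move=> lt_p; apply/idP/hasP => [|[j]]; last first.
  by rewrite mem_iota => /east_position[_ Ep _ _] /eqP->; rewrite Ep.
case Ep: (nth _ _ _) => // _; exists (easts w p).
  by rewrite mem_iota add0n easts_east.
by rewrite -wh ?size_balanced // easts_souths ?size_balanced // ltnW.
Qed.

(** Successive labels, read southeast, in arithmetic form. Constructor names give the directions of
    the two steps; [SouthWrap] joins the last step to the first. The vertical step labeled [a] ends
    at depth [n - a], to be compared with the depths [h e]. *)
Inductive path_succ : nat -> nat -> Prop :=
| SouthEast a e : a < n -> e < n -> a + h e = n ->
    (forall e', e' < e -> a + h e' < n) -> path_succ a (n + e)
| SouthSouth a : a.+1 < n ->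
    (forall e, e < n -> a.+1 + h e != n) -> path_succ a.+1 a
| SouthWrap : 0 < n -> path_succ 0 n
| EastEast e : e.+1 < n -> h e.+1 = h e -> path_succ (n + e) (n + e.+1)
| EastSouth a e : e < n -> a + (h e).+1 = n ->
    (forall e', e < e' < n -> h e < h e') -> path_succ (n + e) a.

Lemma step_label_succ p : p < n + n ->
  path_succ (step_label n w p) (step_label n w (p.+1 %% (n + n))).
Proof.
move=> lt_p; have lt_pw : p < size w by rewrite size_balanced.
have sum_p := easts_souths (ltnW lt_pw).
have Epos e : e < n ->
    (e + h e <= p -> h e <= souths w p) /\ (p <= e + h e -> souths w p <= h e).
  move=> lt_e; have [_ _ _ eq_h] := east_position lt_e.
  by split=> /(leq_souths w); rewrite eq_h.
have pS : p.+1 < n + n -> p.+1 %% (n + n) = p.+1 by exact: modn_small.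
rewrite {1}/step_label; case Ep: (nth East w p).
  have lt_e := easts_east lt_p Ep; have eq_h := wh lt_pw Ep.
  have le_h := h_le (easts w p).
  (* An east step is never the last: its position [e + h e] is at most [2e], and [e < n]. *)
  have lt_p1 : p.+1 < n + n by lia.
  have lt_p1w : p.+1 < size w by rewrite size_balanced.
  rewrite pS // /step_label eastsS // southsS // Ep /= addn0 addn1.
  case Ep1: (nth East w p.+1).
    have := easts_east lt_p1 Ep1; have := wh lt_p1w Ep1.
    by rewrite eastsS // southsS // Ep /= addn0 addn1 => ? ?; apply: EastEast; lia.
  have := souths_south lt_p1 Ep1; rewrite southsS // Ep /= addn0 => lt_s.
  apply: EastSouth => //; first by lia.
  (* Step [p.+1] goes south, so a later east step [e'] sits at [p.+2] or beyond, hence deeper than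
     [h e]. *)
  move=> e' /andP[lt_e' lt_n]; have := leq_souths w (_ : p.+2 <= e' + h e').
  have [_ Ee' _ ->] := east_position lt_n; rewrite !southsS // Ep Ep1 /=.
  have := h_mono (ltnW lt_e'); suff : p.+1 != e' + h e' by lia.
  by apply/eqP => eq_p; rewrite -eq_p Ep1 in Ee'.
have lt_s := souths_south lt_p Ep.
have [lt_p1|le_p1] := ltnP p.+1 (n + n); last first.
  have eq_p1 : p.+1 = n + n by lia.
  rewrite eq_p1 modnn /step_label.
  have eq_s : souths w p.+1 = n.
    by rewrite -wS /souths take_oversize // size_balanced eq_p1.
  rewrite southsS // Ep /= in eq_s.
  have n_gt0 : 0 < n by lia.
  (* Since [h 0 = 0], the path starts with east step 0, whose label is [n]. *)
  have [_ + _ _] := east_position n_gt0.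
  rewrite (_ : 0 + h 0 = 0); last by have := h_le 0; lia.
  move=> ->; rewrite /easts take0 /= addn0.
  rewrite (_ : n - (souths w p).+1 = 0); last by lia.
  exact: SouthWrap.
have lt_p1w : p.+1 < size w by rewrite size_balanced.
rewrite pS // /step_label eastsS // southsS // Ep /= addn0 addn1.
have not_p e : e < n -> p <> e + h e.
  by move=> /east_position[_ Ee _ _] eq_p; rewrite -eq_p Ep in Ee.
case Ep1: (nth East w p.+1).
  have lt_e := easts_east lt_p1 Ep1; have := wh lt_p1w Ep1.
  rewrite eastsS // southsS // Ep /= addn0 addn1 in lt_e * => eq_h.
  apply: SouthEast => //; try lia.
  move=> e' lt_e'; have [|+ _] := Epos e'; first by lia.
  by have := h_mono (ltnW lt_e'); lia.
have := souths_south lt_p1 Ep1; rewrite southsS // Ep /= addn1 => lt_s1.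
rewrite (_ : n - (souths w p).+1 = (n - (souths w p).+2).+1); last by lia.
apply: SouthSouth; first by lia.
move=> e lt_e; have [Ea _] := Epos _ lt_e; have := not_p _ lt_e.
have := leq_souths w (_ : p.+2 <= e + h e).
have [_ Ee _ ->] := east_position lt_e; rewrite !southsS // Ep Ep1 /=.
suff : p.+1 != e + h e by lia.
by apply/eqP => eq_p; rewrite -eq_p Ep1 in Ee.
Qed.

Lemma mem_step_labels k : k < n + n ->
  k \in [seq step_label n w p | p <- iota 0 (size w)].
Proof.
move=> lt_k; apply/mapP; have [lt_kn|le_nk] := ltnP k n.
  have [|p [lt_p Sp eq_s]] := @south_step w (n - k.+1); first by rewrite wS; lia.
  by exists p; rewrite ?mem_iota // /step_label Sp eq_s; lia.
have [|p [lt_p Ep eq_e]] := @east_step w (k - n); first by rewrite wE; lia.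
by exists p; rewrite ?mem_iota // /step_label Ep eq_e; lia.
Qed.

End Heights.

(** The heights fix the positions [j + h j] of all east steps, hence the whole word. *)
Lemma has_heights_unique n h w w' :
  count is_east w = n -> count is_south w = n -> has_heights h w ->
  count is_east w' = n -> count is_south w' = n -> has_heights h w' -> w = w'.
Proof.
move=> wE wS wh w'E w'S w'h; have sz := size_balanced wE wS.
apply: (@eq_from_nth _ East) => [|p]; first by rewrite sz (size_balanced w'E).
rewrite sz => lt_p; have := nth_east w'E w'S w'h lt_p.
by rewrite -(nth_east wE wS wh lt_p); do 2 case: (nth _ _ _).
Qed.

(** * Greedy bases *)

(** After the common prefix, a smaller entry of [t] would be missing from [s], with no entry left in
    [s] below it to compensate. *)
Lemma sorted_lexi_le (s t : seq nat) :
    sorted ltn s -> sorted ltn t -> size s = size t ->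
    (forall k, k \in t -> k \notin s ->
       exists k', [/\ k' < k, k' \in s & k' \notin t]) ->
  ((s : seqlexi nat) <= t)%O.
Proof.
elim: s t => [|a s IHs] [|b t] //= sorted_s sorted_t [eq_size] le_st.
have min_s k : k \in s -> a < k by exact: (allP (order_path_min ltn_trans sorted_s)).
have min_t k : k \in t -> b < k by exact: (allP (order_path_min ltn_trans sorted_t)).
rewrite lexi_cons; case: (ltngtP a b) => [lt_ab|lt_ba|eq_ab].
- by rewrite !leEnat (ltnW lt_ab) leqNgt lt_ab.
- have [||k [lt_kb]] := le_st b; rewrite ?mem_head //.
    by rewrite inE negb_or neq_ltn lt_ba /=; apply/negP => /min_s; lia.
  by rewrite inE => /predU1P[eq_ka|/min_s lt_ak]; lia.
- rewrite !leEnat eq_ab leqnn /=; apply: IHs => //; try exact: path_sorted.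
  + exact: path_sorted sorted_s.
  + exact: path_sorted sorted_t.
  move=> k kt ks; have lt_bk := min_t _ kt.
  have [||k' [lt_k' + +]] := le_st k; first by rewrite inE kt orbT.
    by rewrite inE negb_or ks andbT eq_ab neq_ltn lt_bk orbT.
  rewrite !inE negb_or eq_ab => /predU1P[->|k's]; first by rewrite eqxx.
  by case/andP=> _ k't; exists k'.
Qed.

Section Greedy.

Variables (K : fieldType) (vT : vectType K) (T : finType) (c : T -> vT).

Definition column_span (A : {set T}) : {vspace vT} := <<[seq c x | x in A]>>%VS.

Lemma mem_column_span (A : {set T}) x : x \in A -> c x \in column_span A.
Proof. by move=> Ax; apply/memv_span/image_f. Qed.

Lemma column_span_sub (A : {set T}) (U : {vspace vT}) :
  (forall x, x \in A -> c x \in U) -> (column_span A <= U)%VS.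
Proof. by move=> sAU; apply/span_subvP=> _ /imageP[x Ax ->]; apply: sAU. Qed.

Lemma column_spanS (A B : {set T}) :
  A \subset B -> (column_span A <= column_span B)%VS.
Proof. by move=> /subsetP sAB; apply: column_span_sub => x /sAB/mem_column_span. Qed.

Lemma column_spanU1 x (A : {set T}) :
  column_span (x |: A) = (<[c x]> + column_span A)%VS.
Proof.
apply/eqP; rewrite eqEsubv subv_add -memvE mem_column_span ?setU11 //=.
rewrite column_spanS ?subsetU1 // andbT; apply: column_span_sub => y.
case/setU1P=> [->|/mem_column_span]; first exact: (subvP (addvSl _ _) _ (memv_line _)).
exact: (subvP (addvSr _ _)).
Qed.

(** In the relation expressing [c x], the coefficient of [c y] is nonzero, so the relation can be
    solved for [c y]. *)
Lemma column_span_exchange x y (A : {set T}) :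
  c x \in column_span (y |: A) -> c x \notin column_span A ->
  c y \in column_span (x |: A).
Proof.
rewrite !column_spanU1 => /memv_addP[_ /vlineP[a ->] [v Av def_x]].
have [a_eq0 | a_neq0 notAx] := eqVneq a 0%R.
  by move: def_x; rewrite a_eq0 scale0r add0r => ->; rewrite Av.
suff : (a *: c y)%R \in (<[c x]> + column_span A)%VS by rewrite rpredZeq (negPf a_neq0).
rewrite -(addrK v (a *: c y)%R) -def_x.
by rewrite memvB ?(subvP (addvSl _ _) _ (memv_line _)) ?(subvP (addvSr _ _)).
Qed.

Definition column_free (S : {set T}) : bool := free [seq c x | x in S].

Lemma column_free_notin (S A : {set T}) x :
  column_free S -> x \in S -> A \subset S -> x \notin A ->
  c x \notin column_span A.
Proof.
move=> freeS Sx sAS notAx.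
suff: c x \notin column_span (S :\ x).
  by apply: contra; apply/subvP/column_spanS; rewrite subsetD1 sAS.
have : perm_eq [seq c y | y in S] (c x :: [seq c y | y in S :\ x]).
  rewrite -(map_cons c) perm_map // uniq_perm ?enum_uniq //=.
    by rewrite mem_enum setD11 enum_uniq.
  by move=> y; rewrite inE !mem_enum !inE; case: eqVneq => [->|].
by move/perm_free; rewrite -/(column_free S) freeS free_cons => /esym/andP[].
Qed.

Variable r : T -> nat.
Hypothesis r_inj : injective r.

(** Each element is tested against all earlier ones, selected or not, which avoids a recursion; by
    [greedy_span] the selected ones span the same space. *)
Definition greedy : {set T} :=
  [set x | c x \notin column_span [set y | r y < r x]].

Lemma greedy_span k :
  column_span [set y | r y < k] = column_span [set y in greedy | r y < k].
Proof.
apply/eqP; rewrite eqEsubv; apply/andP; split; last first.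
  by apply/column_spanS/subsetP=> y; rewrite !inE => /andP[].
elim: k => [|k IHk]; first by apply: column_span_sub => y; rewrite inE.
have sub_k : (column_span [set y in greedy | r y < k]
                <= column_span [set y in greedy | r y < k.+1])%VS.
  by apply/column_spanS/subsetP=> y; rewrite !inE => /andP[-> /ltnW].
apply: column_span_sub => y; rewrite inE ltnS leq_eqVlt => /predU1P[eq_k|lt_k].
  have [Gy|] := boolP (y \in greedy).
    by rewrite mem_column_span // inE Gy eq_k leqnn.
  rewrite inE negbK eq_k => /(subvP IHk); exact: (subvP sub_k).
by apply: (subvP sub_k); apply: (subvP IHk); rewrite mem_column_span // inE.
Qed.

Lemma greedy_free : column_free greedy.
Proof.
(* The set is listed by decreasing rank, because [free_cons] tests each vector against those listed
   after it. *)
pose ge_r x y := r y <= r x.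
have ge_r_trans : transitive ge_r by move=> x y z /[swap]; exact: leq_trans.
have ge_r_total : total ge_r by move=> x y; exact: leq_total.
have perm_s : perm_eq (sort ge_r (enum greedy)) (enum greedy).
  exact/permPl/perm_sort.
rewrite /column_free -(perm_free (perm_map c perm_s)).
have uniq_s : uniq (sort ge_r (enum greedy)) by rewrite sort_uniq enum_uniq.
have mem_s x : x \in sort ge_r (enum greedy) -> x \in greedy.
  by rewrite mem_sort mem_enum.
have := sort_sorted ge_r_total (enum greedy).
elim: (sort _ _) uniq_s mem_s => [|x s IHs] /=; first by rewrite nil_free.
case/andP=> notsx uniq_s mem_s path_s; rewrite free_cons IHs //; last first.
- exact: path_sorted path_s.
- by move=> y sy; rewrite mem_s // inE sy orbT.
have := mem_s x (mem_head _ _); rewrite inE andbT; apply: contra.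
apply/subvP/span_subvP=> _ /mapP[y sy ->]; apply: mem_column_span; rewrite inE.
have le_yx : r y <= r x by exact: (allP (order_path_min ge_r_trans path_s)).
by rewrite ltn_neqAle le_yx andbT (inj_eq r_inj); apply: contraNneq notsx => <-.
Qed.

Lemma greedy_card : column_span setT = fullv -> #|greedy| = \dim {:vT}.
Proof.
move=> spanT; rewrite -spanT.
pose k := (\max_x r x).+1.
have lt_k y : r y < k by rewrite ltnS leq_bigmax.
have -> : column_span setT = column_span greedy.
  have -> : [set: T] = [set y | r y < k] by apply/setP=> y; rewrite !inE lt_k.
  by rewrite greedy_span; congr column_span; apply/setP=> y; rewrite !inE lt_k andbT.
have := greedy_free; rewrite /column_free /free size_map -cardE => /eqP <-.
by [].
Qed.

(** With [r := cyclic_rank i] this unfolds to [cyclic_word i]. *)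
Definition rank_word (S : {set T}) : seqlexi nat := sort leq [seq r x | x in S].

Lemma mem_rank_word (S : {set T}) x : (r x \in rank_word S) = (x \in S).
Proof. by rewrite mem_sort mem_image. Qed.

Lemma rank_wordP (S : {set T}) k :
  reflect (exists2 x, x \in S & k = r x) (k \in rank_word S).
Proof.
by rewrite mem_sort; apply: (iffP imageP) => -[x Sx ->]; exists x.
Qed.

Lemma rank_word_sorted (S : {set T}) : sorted ltn (rank_word S).
Proof.
rewrite ltn_sorted_uniq_leq sort_sorted ?andbT; last exact: leq_total.
by rewrite sort_uniq map_inj_uniq // enum_uniq.
Qed.

Lemma rank_word_inj : injective rank_word.
Proof. by move=> S S' eqS; apply/setP=> x; rewrite -!mem_rank_word eqS. Qed.

(** Let [x] in [S] be non-greedy. If all greedy elements before [x] were in [S], they would span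
    [c x], against the freeness of [S]; so an earlier greedy element is missing from [S], as
    [sorted_lexi_le] requires. *)
Lemma greedy_le (S : {set T}) :
  column_free S -> #|S| = #|greedy| -> (rank_word greedy <= rank_word S)%O.
Proof.
move=> freeS cardS; apply: sorted_lexi_le; try exact: rank_word_sorted.
  by rewrite !size_sort !size_map -!cardE.
move=> _ /rank_wordP[x Sx ->]; rewrite mem_rank_word => notGx.
have [/exists_inP[y Gy /andP[notSy lt_yx]]|] :=
    boolP [exists y in greedy, (y \notin S) && (r y < r x)].
  by exists (r y); rewrite !mem_rank_word.
move/exists_inPn => sGS; case/negP: notGx; rewrite inE greedy_span.
apply: column_free_notin freeS Sx _ _; last by rewrite !inE ltnn andbF.
apply/subsetP=> y; rewrite !inE => /andP[Gy lt_yx].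
by have := sGS y; rewrite inE lt_yx andbT negbK; apply.
Qed.

End Greedy.

(** * Cyclic shifts of the order *)

Lemma cyclic_rankE m (i x : 'I_m) :
  cyclic_rank i x = if i <= x then x - i else x + m - i.
Proof.
rewrite /cyclic_rank; have := ltn_ord i; have := ltn_ord x => lt_x lt_i.
case: leqP => [le_ix|lt_xi].
  by rewrite (_ : x + (m - i) = (x - i) + m); [rewrite modnDr modn_small|]; lia.
by rewrite modn_small; lia.
Qed.

Lemma cyclic_rank_inj m (i : 'I_m) : injective (cyclic_rank i).
Proof.
move=> x y; rewrite !cyclic_rankE => eq_xy; apply: val_inj => /=.
have lt_i := ltn_ord i; have lt_x := ltn_ord x; have lt_y := ltn_ord y.
by move: eq_xy; case: leqP => ?; case: leqP => ?; lia.
Qed.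

Lemma cyclic_rank_ordS m (i x : 'I_m) :
  cyclic_rank (ordS i) x = if x == i then m.-1 else (cyclic_rank i x).-1.
Proof.
have -> : (x == i) = (x == i :> nat) by [].
have : ordS i = (if i.+1 < m then i.+1 else 0) :> nat.
  rewrite /=; case: ltnP => [|le_m]; first exact: modn_small.
  by rewrite (_ : i.+1 = m) ?modnn //; have := ltn_ord i; lia.
rewrite !cyclic_rankE => ->; have lt_i := ltn_ord i; have lt_x := ltn_ord x.
by case: ltnP => ?; case: eqVneq => ?; case: leqP => ?; try case: leqP => ?; lia.
Qed.

Section CyclicExchange.

Variables (K : fieldType) (vT : vectType K) (m : nat) (c : 'I_m -> vT).

Definition cyclic_between (i j : 'I_m) : {set 'I_m} :=
  [set y | 0 < cyclic_rank i y < cyclic_rank i j].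

(* Spans increase with j, so j is the first column after i, cyclically, such
   that the columns following i up to j span column i. *)
Definition closes_at (i j : 'I_m) : Prop :=
  [/\ j != i, c i \notin column_span c (cyclic_between i j) &
      c i \in column_span c (j |: cyclic_between i j)].

Lemma cyclic_below (i x : 'I_m) : x != i ->
  [set y | cyclic_rank i y < cyclic_rank i x] = i |: cyclic_between i x.
Proof.
move=> neq_xi; apply/setP=> y; rewrite !inE.
have -> : (y == i) = (cyclic_rank i y == 0).
  by rewrite -(inj_eq (@cyclic_rank_inj m i)) [X in _ == X]cyclic_rankE leqnn subnn.
suff : 0 < cyclic_rank i x by lia.
rewrite lt0n; apply: contra neq_xi => /eqP eq0; apply/eqP/(@cyclic_rank_inj m i).
by rewrite eq0 cyclic_rankE leqnn subnn.
Qed.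

Lemma cyclic_below_ordS (i x : 'I_m) : x != i ->
  [set y | cyclic_rank (ordS i) y < cyclic_rank (ordS i) x] = cyclic_between i x.
Proof.
move=> neq_xi; apply/setP=> y; rewrite !inE !cyclic_rank_ordS (negPf neq_xi).
have rank_i : cyclic_rank i i = 0 by rewrite cyclic_rankE leqnn subnn.
have rank_gt0 z : z != i -> 0 < cyclic_rank i z.
  by move=> neq_zi; rewrite lt0n -rank_i (inj_eq (@cyclic_rank_inj m i)).
have rank_lt z : cyclic_rank i z < m.
  by rewrite /cyclic_rank ltn_mod (leq_trans _ (ltn_ord z)).
have := rank_lt x; have := rank_gt0 x neq_xi.
case: eqVneq => [->|/rank_gt0]; rewrite ?rank_i; lia.
Qed.

(** The shift moves only [i], from first to last, so every other [x] is tested against the same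
    columns with or without [i]. This changes the outcome for [j] alone. *)
Lemma greedy_exchange (i j : 'I_m) : closes_at i j ->
  [/\ i \in greedy c (cyclic_rank i), j \notin greedy c (cyclic_rank i) &
      greedy c (cyclic_rank (ordS i)) = j |: (greedy c (cyclic_rank i) :\ i)].
Proof.
case=> neq_ji notAi Aji.
have rank_i : cyclic_rank i i = 0 by rewrite cyclic_rankE leqnn subnn.
split.
- rewrite inE; apply: contra notAi; apply/subvP/column_spanS/subsetP=> y.
  by rewrite !inE rank_i.
- by rewrite inE negbK cyclic_below //; apply: column_span_exchange.
apply/setP=> x; rewrite !inE; have [->|neq_xi] /= := eqVneq x i.
  rewrite orbC eq_sym (negPf neq_ji) /=; apply/negbTE; rewrite negbK.
  apply: (subvP _ _ Aji); apply/column_spanS/subsetP=> y.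
  rewrite !inE => yA; have neq_yi : y != i.
    by case/predU1P: yA => [->//|]; apply: contraTneq => ->; rewrite rank_i.
  rewrite !cyclic_rank_ordS eqxx (negPf neq_yi).
  have : 0 < cyclic_rank i y.
    by rewrite lt0n -rank_i (inj_eq (@cyclic_rank_inj m i)).
  have : cyclic_rank i y < m by rewrite /cyclic_rank ltn_mod (leq_trans _ (ltn_ord y)).
  lia.
rewrite (cyclic_below neq_xi) (cyclic_below_ordS neq_xi).
have [->|neq_xj] /= := eqVneq x j.
  apply: contra notAi => Aj; apply: (subvP _ _ Aji); rewrite column_spanU1.
  by rewrite subv_add -memvE Aj subvv.
congr (~~ _); apply/idP/idP => [Ax|iAx].
  by apply: (subvP _ _ Ax); apply/column_spanS/subsetU1.
(* Before [j], a change of outcome would by exchange put [c i] in the span of columns strictly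
   between [i] and [j]; after [j], the columns preceding [x] span [c i] even without [i]. *)
have [lt_xj|lt_jx|eq_xj] := ltngtP (cyclic_rank i x) (cyclic_rank i j).
- apply: contraR notAi => notAx.
  have := column_span_exchange iAx notAx; apply/subvP/column_spanS/subsetP=> y.
  rewrite !inE => /predU1P[->|/andP[-> lt_y]]; last exact: ltn_trans lt_xj.
  by rewrite lt_xj lt0n -rank_i (inj_eq (@cyclic_rank_inj m i)) neq_xi.
- apply: (subvP _ _ iAx); rewrite column_spanU1 subv_add subvv andbT -memvE.
  apply: (subvP _ _ Aji); apply/column_spanS/subsetP=> y.
  rewrite !inE => /predU1P[->|/andP[-> lt_y]]; last exact: ltn_trans lt_jx.
  by rewrite lt_jx lt0n -rank_i (inj_eq (@cyclic_rank_inj m i)) neq_ji.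
- by move/(@cyclic_rank_inj m i): eq_xj neq_xj => ->; rewrite eqxx.
Qed.

End CyclicExchange.

(** * Minimal bases and decorated permutation of a column matroid *)

Section ColumnMatroid.

Variables (R : realType) (n m : nat) (M : 'M[R]_(n, m)).
Hypothesis M_full : column_span (fun x => col x M) setT = fullv.

Lemma greedy_basis i : greedy (fun x => col x M) (cyclic_rank i) \in column_matroid M.
Proof.
rewrite inE; apply/andP; split; last by apply: greedy_free; exact: cyclic_rank_inj.
by rewrite greedy_card //; [rewrite dimvf /dim /= muln1 | exact: cyclic_rank_inj].
Qed.

Lemma lex_min_basis_greedy i :
  lex_min_basis (column_matroid M) i = greedy (fun x => col x M) (cyclic_rank i).
Proof.
set G := greedy _ _; have BG := greedy_basis i; rewrite -/G in BG.
have G_min S : S \in column_matroid M -> lex_le i G S.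
  move: BG; rewrite !inE => /andP[/eqP cardG _] /andP[/eqP cardS freeS].
  by apply: greedy_le => //; [exact: cyclic_rank_inj | exact: etrans cardS (esym cardG)].
rewrite /lex_min_basis; case: pickP => [S /andP[BS /forall_inP S_min] /=|/(_ G)].
  apply: (@rank_word_inj _ _ (@cyclic_rank_inj m i)); apply: le_anti.
  by apply/andP; split; [exact: S_min | exact: G_min].
by rewrite BG /=; case/negP; apply/forall_inP=> S /G_min.
Qed.

Variable nxt : 'I_m -> 'I_m.
Hypothesis nxt_closes : forall i, closes_at (fun x => col x M) i (nxt i).

(** No minimal basis equals the next one, so every solution sends [nxt i] to [i]. This makes [nxt]
    injective on a finite set, hence onto, which determines all values and rules out fixed
    points. *)
Lemma column_matroid_decorated_perm (sigma : decorated_perm m) :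
  dp_clockwise sigma = set0 -> (forall i, sigma (nxt i) = i) ->
  unique (decorated_perm_of (column_matroid M)) sigma.
Proof.
move=> cw0 sigmaK; split=> [i | tau tauP] /=.
  rewrite !lex_min_basis_greedy.
  have [Gi notGj eqG] := greedy_exchange (nxt_closes i).
  have [neq_ji _ _] := nxt_closes i.
  split=> [eqGi | _ j neq_j eqGj].
    by move: Gi; rewrite -eqGi eqG !inE eqxx orbF eq_sym (negPf neq_ji).
  suff -> : j = nxt i by [].
  have : nxt i \in j |: greedy (fun x => col x M) (cyclic_rank i) :\ i.
    by rewrite -eqGj eqG setU11.
  by case/setU1P=> [->//|/setD1P[_]]; rewrite (negPf notGj).
have tauK i : tau (nxt i) = i.
  have [_] := tauP i; rewrite !lex_min_basis_greedy.
  have [Gi notGj eqG] := greedy_exchange (nxt_closes i).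
  have [neq_ji _ _] := nxt_closes i; apply=> // eqGi.
  by move: Gi; rewrite -eqGi eqG !inE eqxx orbF eq_sym (negPf neq_ji).
have eq_perm : dp_perm sigma = dp_perm tau.
  apply/permP=> j; have /codomP[i ->] : j \in codom nxt.
    by apply: injF_onto; apply: can_inj tauK.
  by rewrite sigmaK tauK.
have cw0' : dp_clockwise tau = set0.
  apply/setP=> i; rewrite inE; apply/negP => cw_i.
  have /eqP := forall_inP (dp_clockwise_fixed tau) i cw_i.
  rewrite -{2}(tauK i) => /perm_inj eq_i.
  by have [] := nxt_closes i; rewrite -eq_i eqxx.
case: sigma tau cw0 cw0' eq_perm {sigmaK tauP tauK} => [p A pA] [p' A' pA'] /= A0 A'0 eq_p.
rewrite {}A0 {}A'0 {}eq_p in pA pA' *.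
by congr DecoratedPerm; apply: bool_irrelevance.
Qed.

End ColumnMatroid.

(** * Canonical labelings *)

Section Order.

Variables (R : realType) (d : Order.disp_t) (P : finPOrderType d).
Variables (n : nat) (f : 'I_n -> P).
Hypotheses (hP : unit_interval_order R P) (hf : canonical_labeling f).

Let down (x : P) := [set y | (y < x)%O].
Let up (x : P) := [set y | (x < y)%O].

Lemma altitudeE x : altitude x = (#|down x|%:Z - #|up x|%:Z)%R.
Proof.
rewrite /altitude.
have -> : [set y : P | (y <= x)%O] = x |: down x.
  by apply/setP=> y; rewrite !inE le_eqVlt.
have -> : [set y : P | (x <= y)%O] = x |: up x.
  by apply/setP=> y; rewrite !inE le_eqVlt eq_sym.
by rewrite !cardsU1 !inE !ltxx /= !PoszD opprD addrACA subrr add0r.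
Qed.

(** This is the Dyck shape of the zero entries: down-sets grow and up-sets shrink as the label
    increases. *)
Lemma canonical_monotone (i i' j j' : 'I_n) :
  i' <= i -> j <= j' -> (f i < f j)%O -> (f i' < f j')%O.
Proof.
have [q [_ ltq]] := hP; have [_ alt_f] := hf.
have subs x y : (q x <= q y)%R -> down x \subset down y /\ up y \subset up x.
  move=> le_q; split; apply/subsetP=> z; rewrite !inE !ltq => lt_z.
    exact: lt_le_trans lt_z le_q.
  by apply: le_lt_trans lt_z; rewrite lerD2r.
(* A label inversion of q-values forces equal altitudes, hence equal down-sets
   and up-sets. *)
have mono (a b : 'I_n) : a <= b -> down (f a) \subset down (f b) /\ up (f b) \subset up (f a).
  move=> le_ab; have [|lt_q] := leP (q (f a)) (q (f b)); first exact: subs.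
  have [sD sU] := subs _ _ (ltW lt_q).
  have le_alt : (altitude (f a) <= altitude (f b))%R.
    by rewrite leNgt; apply/negP => /alt_f; rewrite ltnNge le_ab.
  move: le_alt; rewrite !altitudeE => le_alt.
  have := subset_leq_card sD; have := subset_leq_card sU => leU leD.
  have /eqP <- : down (f b) == down (f a) by rewrite eqEcard sD; lia.
  have /eqP <- : up (f a) == up (f b) by rewrite eqEcard sU; lia.
  by [].
move=> le_i le_j lt_f.
have : f i' \in down (f j).
  by have [_ /subsetP/(_ (f j))] := mono _ _ le_i; rewrite !inE; apply.
by have [/subsetP/(_ (f i')) + _] := mono _ _ le_j; rewrite !inE => /[apply].
Qed.

Lemma canonical_ltn (i j : 'I_n) : (f i < f j)%O -> i < j.
Proof.
move=> lt_f; rewrite ltnNge; apply/negP => le_ji.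
by have := canonical_monotone (leqnn i) le_ji lt_f; rewrite ltxx.
Qed.

Lemma canonical_heights : exists h : nat -> nat,
  [/\ {homo h : i j / i <= j}, forall j, h j <= j &
      forall i j : 'I_n, (f i < f j)%O = (i < h j)].
Proof.
(* Taking the maximum over all columns up to [k] makes [h] monotone on all of [nat], beyond the
   labels too; a column range without zeros gets height 0. *)
pose below k (i : 'I_n) := [exists j : 'I_n, (j <= k) && (f i < f j)%O].
exists (fun k => \max_(i < n | below k i) i.+1); split.
- move=> k l le_kl; apply/bigmax_leqP => i /existsP[j /andP[le_jk lt_f]].
  apply: (@leq_bigmax_cond _ _ (fun i : 'I_n => i.+1)).
  by apply/existsP; exists j; rewrite (leq_trans le_jk).
- move=> k; apply/bigmax_leqP => i /existsP[j /andP[le_jk /canonical_ltn lt_ij]].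
  exact: leq_trans lt_ij le_jk.
- move=> i j; apply/idP/idP => [lt_f|].
    apply: (@leq_bigmax_cond _ _ (fun i : 'I_n => i.+1)).
    by apply/existsP; exists j; rewrite leqnn.
  apply: contraTT => notlt; rewrite -leqNgt.
  apply/bigmax_leqP => i' /existsP[j' /andP[le_j lt_f]].
  rewrite ltnNge; apply: contra notlt => le_i; exact: canonical_monotone lt_f.
Qed.

End Order.

(** * The columns of psi *)

(** The [if] expressions in the hypothesis are cyclic ranks. The conclusion says that [v] is not an
    end of edge [y], which is [{y, y + 1}] in the first clause and [{0, n - h e}] in the second. *)
Lemma path_succ_between n h i j y : (forall k, h k <= k) -> path_succ n h i j ->
    i < n + n -> j < n + n -> y < n + n ->
    0 < (if i <= y then y - i else y + (n + n) - i)
      < (if i <= j then j - i else j + (n + n) - i) ->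
  let v := if i < n then i else n - h (i - n) in
  (y < n -> (y != v) && (y.+1 != v)) /\
  (forall e, y = n + e -> (0 < v) && (v + h e != n)).
Proof.
move=> h_le ij lt_i lt_j lt_y.
case: ij lt_i lt_j => [a e lt_a lt_e eq_n h_lt|a lt_a h_neq|n_gt0|e lt_e h_eq
  |a e lt_e eq_n h_lt] lt_i lt_j /=.
- rewrite lt_a (_ : a <= n + e); last by lia.
  move=> y_between; have le_ay : a <= y by move: y_between; case: (leqP a y) => ? ?; lia.
  rewrite le_ay in y_between; have := h_le e.
  by split=> [|e' eq_y]; [lia | have := h_lt e'; lia].
- rewrite lt_a ltnn => y_between.
  split=> [|e eq_y]; first by move: y_between; case: (leqP a.+1 y) => ? ?; lia.
  by have := h_neq e; lia.
- rewrite n_gt0 subn0 => y_between; split=> [|e eq_y]; lia.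
- have -> : (n + e < n) = false by lia.
  by move=> y_between; exfalso; move: y_between; rewrite leq_add2l leqnSn;
     case: (leqP (n + e) y) => ? ?; lia.
have -> : (n + e < n) = false by lia.
rewrite (_ : n + e - n = e); last by lia.
rewrite (_ : (n + e <= a) = false); last by lia.
move=> y_between; split=> [lt_yn|e' eq_y].
  by move: y_between; case: (leqP (n + e) y) => ? ?; lia.
have := h_lt e'; have : e < e' by move: y_between; case: (leqP (n + e) y) => ? ?; lia.
lia.
Qed.

Section Columns.

Local Open Scope ring_scope.

Variables (R : realType) (n : nat) (h : nat -> nat) (A : 'M[R]_n).
Hypotheses (h_mono : {homo h : i j / (i <= j)%N}) (h_le : forall j, (h j <= j)%N).
Hypothesis A_h : forall i j, A i j = (h j <= i)%N%:R.

Let c x := col x (psi A).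
Notation cspan := (column_span c).

Lemma psi_lshift a : c (lshift n a) = delta_mx a 0.
Proof.
by apply/matrixP=> i k; rewrite mxE row_mxEl !mxE [k]ord1 eqxx andbT.
Qed.

(** Reversing the rows moves the [h e] zeros of column [e] to the bottom. The remaining rows index
    the edges of the path from 0 to [n - h e], which the edge of column [n + e] closes up. *)
Lemma psi_rshift e :
  c (rshift n e) =
    \sum_(k < n | (k + h e < n)%N) (-1) ^+ (n - k.+1) *: c (lshift n k).
Proof.
apply/matrixP=> i k; rewrite summxE [LHS]mxE row_mxEr mxE A_h [k]ord1.
under eq_bigr do rewrite psi_lshift !mxE eqxx andbT.
rewrite (_ : (h e <= rev_ord i)%N = (i + h e < n)%N); last first.
  by rewrite /=; have := ltn_ord i; lia.
rewrite big_mkcond (bigD1 i) //= eqxx mulr1 big1 ?addr0 => [|l neq_li].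
  by case: ifP; rewrite ?mulr1 ?mulr0.
by rewrite eq_sym (negPf neq_li) mulr0; case: ifP.
Qed.

Lemma psi_full : column_span c setT = fullv.
Proof.
apply/eqP; rewrite eqEsubv subvf; apply/subvP=> x _; rewrite [x]matrix_sum_delta.
apply: memv_suml => i _; apply: memv_suml => j _; rewrite [j]ord1 -psi_lshift.
by rewrite memvZ // mem_column_span.
Qed.

Let term_sum (g : nat -> R) e v :
  \sum_(k < n | (k + h e < n)%N) g k * (k == v :> nat)%:R =
    if (v + h e < n)%N then g v else 0.
Proof.
case: ifP => [lt_v|ge_v].
  have lt_vn : (v < n)%N by lia.
  rewrite (bigD1 (Ordinal lt_vn)) //= eqxx mulr1 big1 ?addr0 // => k /andP[_].
  by rewrite -val_eqE /= => /negPf->; rewrite mulr0.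
rewrite big1 // => k lt_k; case: eqP => [eq_k|]; rewrite ?mulr0 //.
by move: lt_k; rewrite eq_k ge_v.
Qed.

(* U contains exactly the edges avoiding the vertex v. *)
Lemma vertex_hyperplane v : exists U : {vspace 'cV[R]_n},
  (forall a, (c (lshift n a) \in U) = (a != v :> nat) && (a.+1 != v)) /\
  ((0 < v)%N -> forall e, (c (rshift n e) \in U) = (v + h e != n)%N).
Proof.
(* The functional marks the two path edges at [v], and [U] is its kernel. *)
pose u : 'rV[R]_n := \row_k ((k == v :> nat)%:R + (k.+1 == v)%:R).
have u_lshift a : u *m c (lshift n a) = ((a == v :> nat)%:R + (a.+1 == v)%:R)%:M.
  rewrite psi_lshift -colE; apply/matrixP=> i k.
  by rewrite !mxE [i]ord1 [k]ord1 eqxx mulr1n.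
exists (lker (linfun (mulmx u))); split=> [a | ].
  rewrite memv_ker lfunE /= u_lshift -scalemx1 scaler_eq0 oner_eq0 orbF -natrD pnatr_eq0.
  by case: (a == v :> nat); case: (a.+1 == v).
case: v @u u_lshift => // v u u_lshift _ e.
rewrite memv_ker lfunE /= psi_rshift mulmx_sumr.
under eq_bigr do rewrite -scalemxAr u_lshift eqSS scale_scalar_mx mulrDr.
rewrite -raddf_sum big_split /= !(term_sum (fun k => (-1) ^+ (n - k.+1))).
rewrite -scalemx1 scaler_eq0 oner_eq0 orbF.
(* If the path of column [n + e] runs through the vertex, the two contributions have opposite signs
   and cancel; if it stops earlier there is none; if it ends there, one remains. *)
have [lt_v|lt_v|eq_v] := ltngtP (v.+1 + h e)%N n.
- by rewrite (_ : n - v.+1 = (n - v.+2).+1)%N ?exprS ?mulN1r ?subrr ?eqxx; lia.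
- by rewrite add0r eqxx.
- by rewrite add0r signr_eq0.
Qed.

(** The coefficient of term [a] is a sign, so the sum can be solved for that term. *)
Let mem_of_sum (U : {vspace 'cV[R]_n}) (S : pred 'I_n) a : S a ->
  \sum_(k < n | S k) (-1) ^+ (n - k.+1) *: c (lshift n k) \in U ->
  (forall k, S k -> k != a -> c (lshift n k) \in U) -> c (lshift n a) \in U.
Proof.
move=> Sa + US; rewrite (bigD1 a) //= rpredDr; last first.
  by apply: memv_suml => k /andP[Sk neq_k]; rewrite memvZ // US.
by rewrite rpredZeq signr_eq0.
Qed.

Lemma psi_closes (i j : 'I_(n + n)) : path_succ n h i j -> closes_at c i j.
Proof.
(* Hence column [n] is the edge [{0, n}], the signed sum of the whole path. *)
have h0 : h 0 = 0%N by apply/eqP; rewrite -leqn0.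
have sum_all (W : {vspace 'cV[R]_n}) (n_gt0 : (0 < n)%N) :
    c (rshift n (Ordinal n_gt0)) \in W ->
    \sum_(k < n | true) (-1) ^+ (n - k.+1) *: c (lshift n k) \in W.
  by rewrite psi_rshift (eq_bigl predT) // => k; rewrite /= h0 addn0 ltn_ord.
move=> ij; split.
- by apply/eqP => eq_ji; rewrite eq_ji in ij; inversion ij; lia.
- have notU (U : {vspace 'cV[R]_n}) : c i \notin U ->
      (forall y, y \in cyclic_between i j -> c y \in U) ->
    c i \notin column_span c (cyclic_between i j).
    by move=> notU sU; apply: contra notU; apply/subvP/column_span_sub.
  pose v := (if i < n then i : nat else n - h (i - n))%N.
  have [U [Ul Ur]] := vertex_hyperplane v.
  apply: (notU U).
    case: (split_ordP i) => [a eq_i|e eq_i].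
      by rewrite eq_i Ul /v eq_i /= ltn_ord eqxx.
    have eq_v : v = (n - h e)%N by rewrite /v eq_i /= ltnNge leq_addr addKn.
    by rewrite eq_i Ur eq_v; have := h_le e; have := ltn_ord e; lia.
  move=> y; rewrite inE !cyclic_rankE => y_between.
  have [yl yr] := path_succ_between h_le ij (ltn_ord i) (ltn_ord j) (ltn_ord y) y_between.
  case: (split_ordP y) yl yr => [b ->|e' ->] yl yr; first by rewrite Ul; apply: yl.
  by have /andP[v_gt0 neq_v] := yr e' erefl; rewrite Ur.
set W := column_span _ _.
have memW (y : 'I_(n + n)) : y = j :> nat \/
    (0 < (if i <= y then y - i else y + (n + n) - i)
       < (if i <= j then j - i else j + (n + n) - i))%N -> c y \in W.
  move=> y_in; rewrite mem_column_span // !inE -val_eqE /= !cyclic_rankE.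
  by case: y_in => [->|->]; rewrite ?eqxx ?orbT.
have W_all a (n_gt0 : (0 < n)%N) : i = lshift n a ->
    c (rshift n (Ordinal n_gt0)) \in W ->
    (forall k, k != a -> c (lshift n k) \in W) -> c i \in W.
  move=> -> W0 Wk; apply: (mem_of_sum (S := predT)) => // [|k _]; last exact: Wk.
  exact: sum_all W0.
have lt_i := ltn_ord i; have lt_j := ltn_ord j.
inversion ij as [a e lt_a lt_e eq_n h_lt eq_i eq_j|a lt_a h_neq eq_i eq_j
  |n_gt0 eq_i eq_j|e lt_e h_eq eq_i eq_j|a e lt_e eq_n h_lt eq_i eq_j].
(* The cycle consists of the path from [a] to [n] and the edges [{0, n}] and [{0, a}]: subtracting
   column [n + e] from column [n] leaves the terms with [k] at least [a]. *)
- have n_gt0 : (0 < n)%N by lia.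
  have -> : i = lshift n (Ordinal lt_a) by apply: val_inj.
  have W0 : c (rshift n (Ordinal n_gt0)) \in W.
    apply: memW => /=; case: (leqP i (n + 0)) => ?; case: (leqP i j) => ?; lia.
  have We : c (rshift n (Ordinal lt_e)) \in W by apply: memW; left.
  apply: (mem_of_sum (S := fun k => ~~ (k + h e < n)%N)) => [/=|| k]; first by lia.
    have := sum_all W n_gt0 W0.
    by rewrite (bigID (fun k : 'I_n => k + h e < n)%N) /= -(psi_rshift (Ordinal lt_e)) rpredDl.
  rewrite -val_eqE /= => ge_k neq_k; apply: memW => /=; right.
  by case: (leqP i k) => ?; case: (leqP i j) => ?; have := ltn_ord k; lia.
(* Here, and in the next case, the cycle is the whole path closed by [{0, n}]. *)
- have n_gt0 : (0 < n)%N by lia.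
  apply: (W_all (Ordinal lt_a) n_gt0); first by apply: val_inj; rewrite /= -eq_i eq_j.
    by apply: memW => /=; case: (leqP i (n + 0)) => ?; case: (leqP i j) => ?; lia.
  move=> k; rewrite -val_eqE /= => neq_k; apply: memW => /=.
  by case: (leqP i k) => ?; case: (leqP i j) => ?; have := ltn_ord k; lia.
- apply: (W_all (Ordinal n_gt0) n_gt0); first by apply: val_inj.
    by apply: memW; left; rewrite /= addn0.
  move=> k; rewrite -val_eqE /= => neq_k; apply: memW => /=.
  by case: (leqP i k) => ?; case: (leqP i j) => ?; have := ltn_ord k; lia.
(* Equal heights make the two edges parallel. *)
- have lt_e' : (e < n)%N by exact: ltnW.
  suff <- : c j = c i by apply: memW; left.
  have -> : i = rshift n (Ordinal lt_e') by apply: val_inj.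
  have -> : j = rshift n (Ordinal lt_e) by apply: val_inj.
  by rewrite !psi_rshift /= h_eq.
(* The cycle is edge [i] with the path from 0 to [n - h e = a + 1], whose last edge is [j = a]. *)
have -> : i = rshift n (Ordinal lt_e) by apply: val_inj.
rewrite psi_rshift; apply: memv_suml => k /= lt_k; rewrite memvZ //; apply: memW => /=.
by case: (leqP i k) => ?; case: (leqP i j) => ?; have := ltn_ord k; lia.
Qed.

End Columns.

(** * The labels as a cycle *)

Lemma next_nth_mod (T : eqType) (x0 x : T) (s : seq T) : x \in s ->
  next s x = nth x0 s ((index x s).+1 %% size s).
Proof.
rewrite next_nth => s_x; rewrite s_x; move: s_x; rewrite -index_mem.
case: s => [|y s] //; move: (index x _) => k /=; rewrite ltnS leq_eqVlt.
(* At the last entry, the lookup in the tail returns its default value, which is the head [y]. *)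
case/predU1P=> [->|lt_k]; first by rewrite modnn nth_default.
by rewrite modn_small ?ltnS //; apply: set_nth_default.
Qed.

Theorem theorem5p1 (R : realType) (d : Order.disp_t) (P : finPOrderType d)
    (n : nat) (f : 'I_n -> P)
    (hP : unit_interval_order R P) (hf : canonical_labeling f) :
  exists (w : seq step) (sigma : decorated_perm (n + n))
         (s : seq 'I_(n + n)),
    [/\ unique (semiorder_path (antiadjacency R f)) w,
        unique (decorated_perm_of (unit_interval_positroid R f)) sigma,
        [seq val x | x <- s] = northwest_labels n w &
        ufcycle sigma s].
Proof.
have [h [h_mono h_le f_lt]] := canonical_heights hP hf.
have A_h i j : antiadjacency R f i j = ((h j <= i)%N%:R)%R.
  by rewrite mxE f_lt ltnNge; case: leqP.
have [|w [wE wS wh]] := @has_heights_exists h n n h_mono.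
  by move=> j lt_j; exact: leq_trans (h_le j) (ltnW lt_j).
have heightsP v : count is_east v = n -> count is_south v = n ->
    has_heights h v <-> semiorder_path (antiadjacency R f) v.
  move=> vE vS; rewrite (has_heightsP h_le vE vS).
  have A0 (i j : 'I_n) : antiadjacency R f i j = 0%R <-> i < h j.
    rewrite A_h ltnNge; case: leqP => _ /=; split=> // /eqP.
    by rewrite oner_eq0.
  split=> [vh|[_ _ vh] i j lt_i lt_j].
    by split=> // i j; rewrite A0; apply: vh.
  by have := vh (Ordinal lt_i) (Ordinal lt_j); rewrite A0.
have size_w := size_balanced wE wS.
pose labels := [seq step_label n w p | p <- iota 0 (size w)].
have size_labels : size labels = n + n by rewrite size_map size_iota size_w.
(* The [n + n] labels exhaust the numbers below [n + n], so by counting they are distinct. *)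
have labels_all : {subset iota 0 (n + n) <= labels}.
  by move=> k; rewrite mem_iota; apply: mem_step_labels.
have [_ mem_labels] : (size (iota 0 (n + n)) = size labels) * (iota 0 (n + n) =i labels).
  by apply: uniq_min_size => //; rewrite ?iota_uniq // size_iota size_labels.
have uniq_labels : uniq labels.
  by apply: leq_size_uniq labels_all _; rewrite ?iota_uniq // size_iota size_labels.
(* All labels are below [n + n], so [insub] discards none. *)
pose t : seq 'I_(n + n) := pmap insub labels.
have val_t : [seq val x | x <- t] = labels.
  rewrite (pmap_filter (insubK _)); apply/all_filterP/allP => k.
  by rewrite -mem_labels mem_iota => /andP[_ lt_k]; rewrite insubT.
have uniq_t : uniq t by rewrite -(map_inj_uniq val_inj) val_t.
have size_t : size t = n + n by rewrite -(size_map val) val_t.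
have mem_t i : i \in t.
  by rewrite -(mem_map val_inj) val_t -mem_labels mem_iota ltn_ord.
have nth_t x0 p : p < n + n -> nth x0 t p = step_label n w p :> nat.
  move=> lt_p; rewrite -(nth_map _ 0) ?size_t // val_t (nth_map 0) ?size_iota ?size_w //.
  by rewrite nth_iota // size_w.
have next_t (i : 'I_(n + n)) : path_succ n h i (next t i).
  have lt_p : index i t < n + n by apply: leq_trans (eq_leq size_t); rewrite index_mem.
  rewrite (next_nth_mod i (mem_t i)) size_t nth_t; last by rewrite ltn_mod; lia.
  have -> : i = step_label n w (index i t) :> nat by rewrite -(nth_t i) ?nth_index.
  exact: step_label_succ.
(* The exchanges require [next t i] to be sent to [i]; thus the permutation is [prev t], which is
   [next] for the northwest reading [rev t]. *)
have sigma_inj : injective (prev t) by apply: can_inj (next_prev uniq_t).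
have sigma_cw : [forall i in set0, perm sigma_inj i == i].
  by apply/forall_inP=> i; rewrite inE.
exists w, (DecoratedPerm sigma_cw), (rev t); split.
- split=> [|v v_path]; first exact/heightsP.
  have [vE vS _] := v_path; apply: (has_heights_unique wE wS wh vE vS).
  exact/heightsP.
- apply: (@column_matroid_decorated_perm _ _ _ _ _ (next t)) => //.
  + exact: psi_full.
  + by move=> i; apply: psi_closes (next_t i).
  + by move=> i /=; rewrite permE prev_next.
- by rewrite map_rev val_t.
- rewrite /ucycle rev_uniq uniq_t andbT.
  rewrite (eq_cycle (e' := frel (next (rev t)))); first by rewrite cycle_next ?rev_uniq.
  by move=> x y /=; rewrite permE next_rev.
Qed.
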